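(* There exists an absolute constant $c>0$ such that for every positive integer $n$ there exists a permutation $\pi$ of an $n$-element set $\{0,\dots,n-1\}$ whose Hasse diagram $G$ satisfies $$\alpha(G)\leq n\,2^{-c\sqrt{\log n}}\quad\text{and}\quad \chi(G)\geq 2^{c\sqrt{\log n}}.$$
   Context: The Hasse diagram of a permutation $\pi$ of $[n]=\{0,\dots,n-1\}$ is the graph on vertex set $[n]$ in which vertices $i<j$ are joined by an edge if and only if $\pi(i)<\pi(j)$ and there is no $\ell$ with $i<\ell<j$ and $\pi(i)<\pi(\ell)<\pi(j)$. (Equivalently, it is the Hasse diagram, i.e. the graph of covering pairs, of the 2-dimensional poset on the points $(i,\pi(i))$, $i\in[n]$, with the coordinatewise order.) For a graph $G$, $\alpha(G)$ denotes its independence number (the maximum size of a set of pairwise non-adjacent vertices) and $\chi(G)$ its chromatic number. The base of $\log$ (any fixed base greater than $1$) is immaterial, as it only affects the constant $c$. *)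

(* Defs.v *)
From mathcomp Require Import all_boot all_fingroup.

Set Implicit Arguments.
Unset Strict Implicit.
Unset Printing Implicit Defensive.

Record sgraph (T : finType) := SGraph {
  adj :> rel T;
  adj_sym : symmetric adj;
  adj_irrefl : irreflexive adj }.

Definition stable (T : finType) (G : sgraph T) (A : {set T}) : bool :=
  [forall x in A, forall y in A, ~~ G x y].

Definition independence_number (T : finType) (G : sgraph T) : nat :=
  \max_(A : {set T} | stable G A) #|A|.

Definition colorable (T : finType) (G : sgraph T) (k : nat) : bool :=
  [exists f : {ffun T -> 'I_k}, forall x, forall y, G x y ==> (f x != f y)].

Lemma ex_colorable (T : finType) (G : sgraph T) : exists k, colorable G k.
Proof.
exists #|T|; apply/existsP; exists [ffun x => enum_rank x].
apply/forallP=> x; apply/forallP=> y; apply/implyP=> Gxy.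
rewrite !ffunE (inj_eq enum_rank_inj).
by apply: contraTneq Gxy => ->; rewrite adj_irrefl.
Qed.

Definition chromatic_number (T : finType) (G : sgraph T) : nat :=
  ex_minn (ex_colorable G).

Section HasseDiagram.
Variables (n : nat) (p : 'S_n).

Definition covered (i j : 'I_n) : bool :=
  [&& i < j, p i < p j &
    ~~ [exists l : 'I_n, [&& i < l, l < j, p i < p l & p l < p j]]].

Definition hasse_adj (i j : 'I_n) : bool := covered i j || covered j i.

Lemma hasse_adj_sym : symmetric hasse_adj.
Proof. by move=> i j; rewrite /hasse_adj orbC. Qed.

Lemma hasse_adj_irrefl : irreflexive hasse_adj.
Proof. by move=> i; rewrite /hasse_adj /covered ltnn. Qed.

Definition hasse_diagram : sgraph 'I_n := SGraph hasse_adj_sym hasse_adj_irrefl.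

End HasseDiagram.

(* Main.v *)
(* Only the independence number matters, since chi * alpha >= n.  One step turns
   a configuration of N points and independence ratio d into one of
   N * poly(1/d) points and ratio at most 3d/4, so that ratio (3/4)^k is reached
   with 2^O(k^2) points.  Blow each point of the old configuration up to a
   decreasing sequence, and put m copies of the result side by side in columns,
   so that each blown-up point v occupies a whole row of m points.  Inside each
   row shuffle the points by random signs, in such a way that an independent set
   must agree with the signs of a step function of the column.  For a fixed
   choice of step functions and of independent sets of the columns, the
   agreement has mean half of the size of the sets; the blow-up makes the number
   of choices so small that a union bound leaves signs for which the agreement
   is never above 3/4. *)

Require Import Defs.
From HB Require Import structures.
From mathcomp Require Import all_boot all_order all_algebra all_fingroup.
From mathcomp Require Import all_classical all_reals all_analysis.
From mathcomp Require Import zify ring lra.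

Set Implicit Arguments.
Unset Strict Implicit.
Unset Printing Implicit Defensive.

Import Order.TTheory GRing.Theory Num.Theory.

(** * Covering pairs of planar point configurations *)

Definition covers (T : finType) (x y : T -> nat) (u v : T) : bool :=
  [&& x u < x v, y u < y v &
    ~~ [exists l, [&& x u < x l, x l < x v, y u < y l & y l < y v]]].

Definition cover_free (T : finType) (x y : T -> nat) (A : {set T}) : bool :=
  [forall u in A, forall v in A, ~~ covers x y u v].

(** Arbitrary injective coordinates, instead of a permutation, leave room for lexicographic
    constructions; ranks are taken only at the end. *)
Definition realizes (N a : nat) : Prop :=
  exists (T : finType) (x y : T -> nat),
    [/\ injective x, injective y, #|T| = N &
      forall A, cover_free x y A -> #|A| <= a].

Lemma cover_freeP (T : finType) (x y : T -> nat) (A : {set T}) :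
  reflect {in A &, forall u v, ~~ covers x y u v} (cover_free x y A).
Proof.
apply: (iffP 'forall_in_forall_inP) => [h u v uA vA | h u uA v vA]; exact: h.
Qed.

Lemma coversP (T : finType) (x y : T -> nat) (u v : T) :
  reflect [/\ x u < x v, y u < y v & forall l,
    x u < x l -> x l < x v -> y u < y l -> y l < y v -> False] (covers x y u v).
Proof.
apply: (iffP and3P) => -[xuv yuv]; last first.
  move=> h; split=> //; apply/existsP => -[l /and4P[]]; exact: h.
move=> h; split=> // l h1 h2 h3 h4; case/existsP: h; exists l; exact/and4P.
Qed.

Lemma lex_lt B a b c d : b < B -> d < B ->
  (a * B + b < c * B + d) = (a < c) || (a == c) && (b < d).
Proof. by move=> bB dB; case: (ltngtP a c) => h /=; [nia|nia|subst; lia]. Qed.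

Lemma lex_eq B a b c d : b < B -> d < B ->
  (a * B + b == c * B + d) = (a == c) && (b == d).
Proof. by move=> bB dB; case: (ltngtP a c) => h /=; [nia|nia|subst; lia]. Qed.

Lemma bounded_fun (T : finType) (f : T -> nat) : exists B, forall u, f u < B.
Proof.
by exists (\max_u f u).+1 => u; rewrite ltnS; apply: (leq_bigmax u).
Qed.

(** * Small configurations, restriction and copies *)

Lemma realizes_point : realizes 1 1.
Proof.
exists unit, (fun=> 0), (fun=> 0); split; try by case=> [[]].
  by rewrite card_unit.
by move=> A _; rewrite -card_unit max_card.
Qed.

Lemma realizes_chain2 : realizes 2 1.
Proof.
exists bool, nat_of_bool, nat_of_bool.
split; [by case=> [] []|by case=> [] []|by rewrite card_bool|].
move=> A /cover_freeP Afree; apply/card_le1_eqP => u v uA vA.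
suff: ~~ ((false \in A) && (true \in A)).
  by move: u v uA vA => [] [] // -> ->.
apply/negP => /andP[fA tA]; move/negP: (Afree _ _ fA tA); apply.
by apply/coversP; split=> // -[].
Qed.

(** A covering pair of the full configuration stays covering when other points are deleted. *)
Lemma realizes_sub N n a : n <= N -> realizes N a -> realizes n a.
Proof.
move=> nN [T [x [y [xI yI cT Aa]]]].
pose f (i : 'I_n) : T := enum_val (cast_ord (esym cT) (widen_ord nN i)).
have fI : injective f.
  by move=> i j /enum_val_inj /cast_ord_inj /(congr1 val) /= /val_inj.
exists 'I_n, (x \o f), (y \o f); split; try exact: inj_comp.
  by rewrite card_ord.
move=> A /cover_freeP Afree; rewrite -(card_imset _ fI); apply: Aa.
apply/cover_freeP => _ _ /imsetP[i iA ->] /imsetP[j jA ->].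
apply: contra (Afree i j iA jA) => /coversP[h1 h2 h3].
by apply/coversP; split=> // l; apply: h3.
Qed.

Lemma card_slices (I T : finType) (A : {set I * T}) :
  #|A| = \sum_i #|[set u | (i, u) \in A]|.
Proof.
rewrite -sum1_card (eq_bigl (fun p => true && ((p.1, p.2) \in A))); last by case.
rewrite -(pair_big_dep predT (fun i u => (i, u) \in A) (fun _ _ => 1)) /=.
by apply: eq_bigr => i _; rewrite -sum1_card; apply: eq_bigl => u; rewrite inE.
Qed.

(** The copies are placed along an increasing diagonal, so a point between two points of one copy
    lies in that copy. *)
Lemma realizes_copies c N a : realizes N a -> realizes (c * N) (c * a).
Proof.
move=> [T [x [y [xI yI cT Aa]]]].
have [X xX] := bounded_fun x; have [Y yY] := bounded_fun y.
pose X' (u : 'I_c * T) := u.1 * X + x u.2; pose Y' (u : 'I_c * T) := u.1 * Y + y u.2.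
exists ('I_c * T)%type, X', Y'.
split.
- by move=> [i u] [j v] /eqP; rewrite lex_eq // => /andP[/eqP/val_inj/= -> /eqP/xI->].
- by move=> [i u] [j v] /eqP; rewrite lex_eq // => /andP[/eqP/val_inj/= -> /eqP/yI->].
- by rewrite card_prod card_ord cT.
move=> A /cover_freeP Afree.
have -> : c * a = \sum_(i < c) a by rewrite sum_nat_const card_ord.
rewrite card_slices.
apply: leq_sum => i _; apply: Aa; apply/cover_freeP => u v; rewrite !inE => uA vA.
apply: contra (Afree _ _ uA vA) => /coversP[h1 h2 h3].
apply/coversP; rewrite /X' /Y' !lex_lt //= !eqxx !ltnn /=; split=> // -[k l] /=.
rewrite !lex_lt //= => g1 g2 g3 g4.
have ki : k = i :> nat by lia.
apply: (h3 l); lia.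
Qed.

(** * Amplification by random signs *)

(* Markov's inequality: [3 ^ agree] has mean [2 ^ #|Z p| <= 16 ^ M] over all [e],
   while more than [3 * M] agreements make it larger than [27 ^ M]. *)
Lemma exists_sign (T P : finType) (Z : P -> {set T}) (g : P -> T -> bool) M :
  #|P| * 16 ^ M < 27 ^ M ->
  exists e : {ffun T -> bool}, forall p, #|Z p| <= 4 * M ->
    #|[set z in Z p | e z == g p z]| <= 3 * M.
Proof.
move=> ltP.
pose agree p (e : {ffun T -> bool}) := #|[set z in Z p | e z == g p z]|.
suff /existsP[e /forallP eP] :
    [exists e, [forall p, (#|Z p| <= 4 * M) ==> (agree p e <= 3 * M)]].
  by exists e => p; apply/implyP.
apply: contraLR ltP => /existsPn bad; rewrite -leqNgt.
have sumE p : \sum_e 3 ^ agree p e = 2 ^ #|T| * 2 ^ #|Z p|.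
  have agE e : 3 ^ agree p e =
      \prod_z (if (z \in Z p) && (e z == g p z) then 3 else 1).
    rewrite -big_mkcond /= -prod_nat_const; apply: eq_bigl => z.
    by rewrite !inE.
  rewrite (eq_bigr _ (fun e _ => agE e)).
  (* The sum over [e] factors over [z], with factor 3 + 1 inside [Z p] and 1 + 1 outside. *)
  rewrite -(bigA_distr_bigA (fun z b =>
    if (z \in Z p) && (b == g p z) then 3 else 1)).
  rewrite -!prod_nat_const big_mkcond [X in _ = _ * X]big_mkcond -big_split /=.
  apply: eq_bigr => z _; rewrite big_bool.
  by case: (z \in Z p); case: (g p z).
have le1 : 2 ^ #|T| * 27 ^ M
    <= \sum_e \sum_(p | #|Z p| <= 4 * M) 3 ^ agree p e.
  have -> : 2 ^ #|T| = #|{ffun T -> bool}| by rewrite card_ffun card_bool.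
  rewrite -sum_nat_const; apply: leq_sum => e _.
  have /forallPn[p] := bad e; rewrite negb_imply -ltnNge => /andP[Zp ltp].
  rewrite (bigD1 p) //= (leq_trans _ (leq_addr _ _)) //.
  by rewrite -[27]/(3 ^ 3) -expnM leq_exp2l // ltnW.
have le2 : \sum_e \sum_(p | #|Z p| <= 4 * M) 3 ^ agree p e
    <= 2 ^ #|T| * (#|P| * 16 ^ M).
  rewrite exchange_big /= mulnCA -sum_nat_const big_mkcond /=.
  apply: leq_sum => p _; case: ifP => // Zp.
  rewrite sumE leq_mul2l; apply/orP; right.
  by rewrite -[16]/(2 ^ 4) -expnM leq_exp2l.
by rewrite -(@leq_pmul2l (2 ^ #|T|)) ?expn_gt0 // (leq_trans le1).
Qed.

Lemma expn4_le s i j k : i * (j * j * j * j) <= k * k * k * k ->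
  i ^ s * j ^ (4 * s) <= k ^ (4 * s).
Proof.
have -> : 4 * s = s + s + s + s by lia.
case: s => // s le_ijk; rewrite !expnD -!expnMn.
by rewrite leq_exp2r.
Qed.

(* A point is [(t, (w, j))].  Each column [t] is the old configuration with
   its points blown up to decreasing sequences of length [16 * q]; in each row
   the points of sign [true] lie above those of sign [false], and both form
   decreasing sequences, so that a point of sign [false] is covered by every
   point of sign [true] to its right. *)
Lemma realizes_amplify N a m q :
  realizes N a -> 0 < q * m * a -> N <= q * a ->
  m.+1 ^ (16 * N) <= 2 ^ (m * a) ->
  realizes (m * (16 * q) * N) (12 * (q * m * a)).
Proof.
move=> [W [x [y [xI yI cW Wa]]]] s_gt0 Nqa lem.
pose Q := 16 * q; pose V := (W * 'I_Q)%type.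
(* [p] holds a threshold for each row and a set for each column; [Z p] is the blow-up of these sets,
   and [g p] predicts sign [true] left of the threshold. *)
pose Z (p : {ffun V -> 'I_m.+1} * {ffun 'I_m -> {set W}}) : {set 'I_m * V} :=
  [set z | z.2.1 \in p.2 z.1].
pose g (p : {ffun V -> 'I_m.+1} * {ffun 'I_m -> {set W}}) (z : 'I_m * V) :=
  z.1 < p.1 z.2.
have [e eP] : exists e : {ffun 'I_m * V -> bool},
    forall p, #|Z p| <= 4 * (4 * (q * m * a)) ->
      #|[set z in Z p | e z == g p z]| <= 3 * (4 * (q * m * a)).
  apply: exists_sign; rewrite card_prod !card_ffun card_prod !card_ord.
  rewrite -(cardsT {set W}) -powersetT card_powerset cardsT cW.
  set s := q * m * a in s_gt0 *.
  have b1 : m.+1 ^ (N * Q) <= 2 ^ s.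
    have -> : N * Q = 16 * N * q by rewrite /Q; lia.
    have -> : s = m * a * q by rewrite /s; lia.
    by rewrite !(expnM _ _ q) leq_exp2r //; lia.
  have b2 : (2 ^ N) ^ m <= 2 ^ s by rewrite -expnM leq_exp2l // /s; nia.
  (* Here 8 * 16^4 = 524288 is below 27^4 = 531441. The factor [8 ^ s] strictly exceeds the number
     of [p], a product of two counts of at most [2 ^ s]. *)
  have b3 : 8 ^ s * 16 ^ (4 * s) <= 27 ^ (4 * s).
    by apply: expn4_le; lia.
  apply: leq_trans b3; rewrite ltn_pmul2r ?expn_gt0 //.
  have -> : 8 ^ s = 2 ^ s * (2 ^ s * 2 ^ s) by rewrite -!expnMn.
  have : 1 < 2 ^ s by rewrite -{1}(expn0 2) ltn_exp2l.
  move: b1 b2; set A := m.+1 ^ _; set B := (_ ^ m); set C := 2 ^ s; nia.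
have [X xX] := bounded_fun x; have [Y yY] := bounded_fun y.
pose x' (z : 'I_m * V) := (z.1 * X + x z.2.1) * Q + z.2.2.
pose y' (z : 'I_m * V) :=
  ((y z.2.1 * Q + rev_ord z.2.2) * 2 + e z) * m + rev_ord z.1.
have e2 (b : bool) : b < 2 by case: b.
have x'P u v : (x' u < x' v) = [|| u.1 < v.1, (u.1 == v.1 :> nat) && (x u.2.1 < x v.2.1) |
    [&& u.1 == v.1 :> nat, u.2.1 == v.2.1 & u.2.2 < v.2.2]].
  by rewrite /x' !lex_lt // lex_eq // (inj_eq xI) -orbA -andbA.
have revlt k (i j : 'I_k) : (rev_ord i < rev_ord j) = (j < i).
  by rewrite /=; move: (ltn_ord i) (ltn_ord j); lia.
have y'P u v : (y' u < y' v) = [|| y u.2.1 < y v.2.1,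
    (u.2.1 == v.2.1) && (v.2.2 < u.2.2) |
    [&& u.2.1 == v.2.1, u.2.2 == v.2.2 :> nat &
      (e u < e v) || (e u == e v) && (v.1 < u.1)]].
  rewrite /y' !lex_lt // !lex_eq // !revlt (inj_eq yI) (inj_eq val_inj).
  rewrite (inj_eq rev_ord_inj) -[u.2.2 == v.2.2]val_eqE /=.
  rewrite (_ : (e u == e v :> nat) = (e u == e v)); last by case: (e u); case: (e v).
  by case: (u.2.1 == _); case: (u.2.2 == _ :> nat); rewrite /= ?orbF ?orbA.
exists ('I_m * V)%type, x', y'; split.
- move=> [t [w j]] [t' [w' j']] /eqP; rewrite !lex_eq //=.
  by rewrite (inj_eq xI) => /andP[/andP[/eqP/val_inj/= -> /eqP->] /eqP/val_inj/= ->].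
- move=> [t [w j]] [t' [w' j']] /eqP; rewrite !lex_eq // (inj_eq yI) !(inj_eq val_inj).
  rewrite !(inj_eq rev_ord_inj) /=.
  by move=> /andP[/andP[/andP[/eqP-> /eqP->] _] /eqP->].
- by rewrite !card_prod !card_ord cW /Q; lia.
move=> S /cover_freeP Sfree.
(* The threshold is just past the last point of [S] with sign [true] in row [v], and 0 if there is
   none. *)
pose th (v : V) : 'I_m.+1 :=
  inord (\max_(t : 'I_m | ((t, v) \in S) && e (t, v)) t.+1).
pose I (t : 'I_m) : {set W} := [set w | [exists j, (t, (w, j)) \in S]].
pose p := ([ffun v => th v], [ffun t => I t]).
(* If [w'] covers [w], then within a column each copy of [w'] covers each copy of [w], because the
   copies of one point are incomparable there. *)
have Ia t : #|I t| <= a.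
  apply: Wa; apply/cover_freeP => w w'; rewrite !inE => /existsP[j wS] /existsP[j' wS'].
  apply: contra (Sfree _ _ wS wS') => /coversP[h1 h2 h3].
  apply/coversP; rewrite x'P y'P /= eqxx h1 h2 /= orbT; split=> // -[t1 [w1 j1]].
  rewrite !x'P !y'P /= => g1 g2 g3 g4.
  have t1E : t1 = t by apply: val_inj => /=; move: g1 g2; lia.
  subst t1; move: g1 g2; rewrite !ltnn !eqxx /= => g1 g2.
  have [w1E|/eqP nw1] := eqVneq w w1.
    subst w1; move: g1 g3; rewrite !ltnn !eqxx /= => g1.
    by lia.
  have [w1E|/eqP nw2] := eqVneq w1 w'.
    subst w1; move: g2 g4; rewrite !ltnn !eqxx /= => g2.
    by lia.
  by apply: (h3 w1); move: g1 g2 g3 g4;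
    rewrite ?(introF eqP nw1) ?(introF eqP nw2) /= ?orbF.
have Zp : #|Z p| <= 4 * (4 * (q * m * a)).
  have -> : 4 * (4 * (q * m * a)) = \sum_(i < m) a * Q.
    by rewrite sum_nat_const card_ord /Q; lia.
  rewrite card_slices; apply: leq_sum => t _.
  rewrite (_ : [set u | _] = finset.setX (I t) [set: 'I_Q]).
    by rewrite cardsX cardsT card_ord leq_mul2r Ia orbT.
  by apply/setP => -[w j]; rewrite !inE /= ffunE !inE andbT.
apply: (@leq_trans #|[set z in Z p | e z == g p z]|); last first.
  by apply: leq_trans (eP _ Zp) _; lia.
apply/fintype.subset_leq_card/fintype.subsetP => -[t v] zS.
rewrite !inE /g /= !ffunE inE.
have le_m : \max_(t : 'I_m | ((t, v) \in S) && e (t, v)) t.+1 < m.+1.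
  by rewrite ltnS; apply/bigmax_leqP.
apply/andP; split; first by apply/existsP; exists v.2; case: (v) zS.
rewrite inordK //; case et: (e (t, v)); apply/eqP/esym.
  by apply: (bigop.bigmax_sup t) => //; rewrite zS et.
(* A point of [S] with sign [true] further right in the row would cover the present point of sign
   [false]. *)
apply/negbTE; rewrite -leqNgt; apply/bigmax_leqP => t' /andP[t'S et'].
rewrite leqNgt; apply/negP => lt_tt'.
have {lt_tt'} lt_tt' : t < t'.
  by rewrite ltn_neqAle -ltnS lt_tt' andbT; apply: contraTneq et' => /val_inj <-; rewrite et.
(* Nothing in the row lies in between: above the lower point, sign [false] occurs only left of [t];
   below the upper one, sign [true] occurs only right of [t']. *)
case/negP: (Sfree _ _ zS t'S); apply/coversP.
rewrite x'P y'P /= !eqxx !ltnn et et' lt_tt'; split=> // -[t1 [w1 j1]].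
rewrite !x'P !y'P /= et et' => g1 g2 g3 g4.
have [w1E|/negbTE nw1] := eqVneq v.1 w1; last first.
  by move: g3 g4; rewrite [w1 == _]eq_sym nw1 /= !orbF; lia.
subst w1; move: g1 g2 g3 g4; rewrite !ltnn !eqxx /=.
by case: (e _); rewrite /= ?orbF; lia.
Qed.

(** * Iteration of the amplification *)

Lemma leq_wexp2r m n e : m <= n -> m ^ e <= n ^ e.
Proof. by case: e => // e; rewrite leq_exp2r. Qed.

Lemma realizes_tower k : exists N a,
  [/\ realizes N a, 0 < a, 4 ^ k * a = 3 ^ k * N & N <= 2 ^ (15 * k ^ 2)].
Proof.
elim: k => [|k [N [a [rNa a_gt0 Na leN]]]].
  by exists 1, 1; split=> //; exact: realizes_point.
(* The ratio (3/4)^k is at least 2^-k, so [2 ^ k] can serve as [q]. *)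
have Nqa : N <= 2 ^ k * a.
  rewrite -(@leq_pmul2l (3 ^ k)) ?expn_gt0 // -Na mulnA -expnMn leq_mul2r.
  by rewrite leq_wexp2r ?orbT.
(* Since m + 1 <= 2^(2k+9), the condition on [m] reduces to 2k + 9 <= 16 * 2^k. *)
pose m := 2 ^ (2 * k + 8).
have m_gt0 : 0 < m by rewrite expn_gt0.
have m2k : m = 2 ^ k * 2 ^ k * 256.
  by rewrite /m mul2n -addnn !expnD.
exists (m * (16 * 2 ^ k) * N), (12 * (2 ^ k * m * a)); split.
- apply: realizes_amplify => //; first by rewrite !muln_gt0 expn_gt0 m_gt0.
  apply: (@leq_trans (m.+1 ^ (16 * (2 ^ k * a)))).
    by rewrite leq_exp2l ?leq_mul2l.
  have -> : 16 * (2 ^ k * a) = 16 * 2 ^ k * a by rewrite mulnA.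
  rewrite !(expnM _ _ a) leq_exp2r //.
  apply: (@leq_trans ((2 ^ (2 * k + 9)) ^ (16 * 2 ^ k))).
    rewrite leq_exp2r ?muln_gt0 ?expn_gt0 //.
    by rewrite (_ : 2 * k + 9 = (2 * k + 8).+1) ?expnS -/m; lia.
  rewrite -expnM leq_exp2l // m2k.
  have : k < 2 ^ k by rewrite ltn_expl.
  by move: (2 ^ k) => K; nia.
- by rewrite !muln_gt0 expn_gt0 m_gt0.
- rewrite !expnS; move: Na; move: (4 ^ k) (3 ^ k) (2 ^ k) => A B K Na.
  have -> : 4 * A * (12 * (K * m * a)) = 48 * (K * m) * (A * a) by lia.
  by rewrite Na; lia.
(* The number of points grows by the factor 2^(3k+12), and 3k + 12 <= 15(2k + 1). *)
apply: leq_trans (_ : 2 ^ (2 * k + 8) * (2 ^ 4 * 2 ^ k) * 2 ^ (15 * k ^ 2) <= _).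
  by rewrite leq_mul2l leN orbT.
by rewrite -!expnD leq_exp2l // !expnS !expn0; lia.
Qed.

(** Three steps of the tower gain 27/64 < 1/2. The exponent 15 * 9 = 135 is rounded up to the square
    144, with a later square root in view. *)
Lemma realizes_halving j : exists N a,
  [/\ realizes N a, 0 < N, a * 2 ^ j <= N & N <= 2 ^ (144 * j ^ 2)].
Proof.
have [N [a [rNa a_gt0 Na leN]]] := realizes_tower (3 * j).
have N_gt0 : 0 < N.
  case: N Na {rNa leN} => // /eqP.
  by rewrite muln0 muln_eq0 expn_eq0 /= eqn0Ngt a_gt0.
exists N, a; split=> //.
  rewrite -(@leq_pmul2r (32 ^ j)) ?expn_gt0 // -mulnA -expnMn mulnC.
  move: Na; rewrite !expnM => ->; rewrite mulnC leq_mul2l.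
  by apply/orP; right; rewrite leq_wexp2r.
apply: leq_trans leN _; rewrite leq_exp2l //.
by rewrite expnMn; lia.
Qed.

(** * From configurations to permutations *)

Lemma exists_rank (T : finType) (f : T -> nat) n : #|T| = n ->
  exists r : T -> 'I_n, forall u v, (r u < r v) = (f u < f v).
Proof.
move=> cT.
have rk_lt u : #|[set w | f w < f u]| < n.
  rewrite -cT -cardsT; apply: proper_card; apply/properP; split.
    exact: finset.subsetT.
  by exists u; rewrite !inE ?ltnn.
exists (fun u => Ordinal (rk_lt u)) => u v /=.
have mono w w' : f w <= f w' -> #|[set t | f t < f w]| <= #|[set t | f t < f w']|.
  move=> le; apply: fintype.subset_leq_card; apply/fintype.subsetP => t.
  by rewrite !inE => /leq_trans; apply.
case: (ltnP (f u) (f v)) => le; last by apply/negbTE; rewrite -leqNgt mono.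
apply: proper_card; apply/properP; split; last by exists u; rewrite !inE ?ltnn.
by apply/fintype.subsetP => t; rewrite !inE => /ltn_trans; apply.
Qed.

Lemma realizes_perm n a : realizes n a ->
  exists p : 'S_n, independence_number (hasse_diagram p) <= a.
Proof.
move=> [T [x [y [xI yI cT Ta]]]].
have [r rP] := exists_rank x cT; have [s sP] := exists_rank y cT.
have lt_inj (f : T -> nat) (q : T -> 'I_n) : injective f ->
    (forall u v, (q u < q v) = (f u < f v)) -> injective q.
  move=> fI qP u v quv; apply: fI.
  by case: (ltngtP (f u) (f v)) => //; rewrite -qP quv ltnn.
have rI := lt_inj _ _ xI rP; have sI := lt_inj _ _ yI sP.
have [g rK gK] : bijective r by apply: inj_card_bij; rewrite ?cT ?card_ord.
have pI : injective (s \o g) by apply: inj_comp => //; exact: can_inj gK.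
have gE (i j : 'I_n) : (i < j) = (x (g i) < x (g j)) by rewrite -rP !gK.
exists (perm pI); apply/bigop.bigmax_leqP => A stA.
rewrite -(card_imset _ (can_inj gK)); apply: Ta.
apply/cover_freeP => _ _ /imsetP[i iA ->] /imsetP[j jA ->].
have /forall_inP/(_ i iA)/forall_inP/(_ j jA) := stA.
apply: contra => /coversP[h1 h2 h3]; apply/orP; left; apply/and3P.
rewrite !permE /= sP gE; split=> //.
apply/existsP => -[l /and4P[]]; rewrite !permE /= !sP.
rewrite !gE; exact: h3.
Qed.

Lemma card_le_chromatic_independence (T : finType) (G : sgraph T) :
  #|T| <= chromatic_number G * independence_number G.
Proof.
rewrite /chromatic_number; case: ex_minnP => k /existsP[f /forallP fP] _.
rewrite -sum1_card (partition_big f predT) //=.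
have -> : k * independence_number G = \sum_(c < k) independence_number G.
  by rewrite sum_nat_const card_ord.
apply: leq_sum => c _; rewrite sum1_card.
rewrite (_ : #|_| = #|[set u | f u == c]|); last by apply: eq_card => u; rewrite inE.
apply: (bigop.bigmax_sup [set u | f u == c]) => //.
apply/forall_inP => u; rewrite inE => /eqP fu.
apply/forall_inP => v; rewrite inE => /eqP fv.
by apply: contraTN (forallP (fP u) v) => ->; rewrite fu fv eqxx.
Qed.

(** [j] is the largest value with 2^(144 j^2) <= n. Covering [n] by whole copies costs a factor of
    at most 2, hence [j.-1]. For j <= 1 that bound is void, and copies of a 2-chain give ceil(n/2)
    <= 2n/3 instead. *)
Lemma exists_sparse_perm n : 1 < n -> exists (p : 'S_n) (j : nat),
  n < 2 ^ (144 * j.+1 ^ 2) /\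
  let alpha := independence_number (hasse_diagram p) in
  if j <= 1 then 3 * alpha <= 2 * n else alpha * 2 ^ j.-1 <= n.
Proof.
move=> n_gt1.
have [|i|j lejn maxj] := @ex_maxnP (fun j => 2 ^ (144 * j ^ 2) <= n) n.
- by exists 0; lia.
- move=> lein; apply: leq_trans (_ : 2 ^ i <= _); first exact/ltnW/ltn_expl.
  by apply: leq_trans lein; rewrite leq_exp2l //; nia.
have ltn_j : n < 2 ^ (144 * j.+1 ^ 2).
  by rewrite ltnNge; apply/negP => /maxj; rewrite ltnn.
case: (leqP j 1) => [j1|j_gt1].
  have /realizes_perm[p lep] : realizes n (uphalf n * 1).
    apply: realizes_sub (realizes_copies _ realizes_chain2); lia.
  exists p, j; rewrite j1; split=> //=; lia.
have [N [a [rNa N_gt0 leaN leN]]] := realizes_halving j.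
have /realizes_perm[p lep] : realizes n ((n %/ N).+1 * a).
  apply: realizes_sub (realizes_copies _ rNa).
  by rewrite ltnW // -ltn_divLR.
exists p, j; rewrite (leqNgt j 1) j_gt1; split=> //=.
rewrite -(@leq_pmul2r 2) // -mulnA -expnSr prednK; last by lia.
apply: leq_trans (_ : (n %/ N).+1 * a * 2 ^ j <= _); first by rewrite leq_mul2r lep orbT.
rewrite -mulnA; apply: leq_trans (_ : (n %/ N).+1 * N <= _).
  by rewrite leq_mul2l leaN orbT.
by have := leq_trunc_div n N; have := leq_trans leN lejn; lia.
Qed.

(** * The bounds with real exponents *)

Local Open Scope ring_scope.

Theorem theorem2 (R : realType) :
  exists c : R, 0 < c /\
    forall n : nat, (0 < n)%N ->
      exists p : 'S_n,
        (independence_number (hasse_diagram p))%:R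
          <= n%:R * 2 `^ (- (c * Num.sqrt (ln (n%:R : R)))) :> R
        /\ 2 `^ (c * Num.sqrt (ln (n%:R : R)))
          <= (chromatic_number (hasse_diagram p))%:R :> R.
Proof.
(* From sqrt(ln n) <= 12(j + 1), the constant 1/48 gives e <= (j + 1)/4, which is at most 1/2 for j
   <= 1 and at most j - 1 for j >= 2. *)
exists (1 / 48); split; first by rewrite divr_gt0.
move=> n n_gt0; set e := 1 / 48 * Num.sqrt (ln (n%:R : R)).
suff [p alpha_le] : exists p : 'S_n,
    (independence_number (hasse_diagram p))%:R * 2 `^ e <= n%:R :> R.
  exists p; split; first by rewrite powRN ler_pdivlMr // powR_gt0.
  set alpha := independence_number _ in alpha_le *.
  have le_n := card_le_chromatic_independence (hasse_diagram p).
  rewrite card_ord -/alpha in le_n.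
  have alpha_gt0 : 0 < alpha%:R :> R by rewrite ltr0n; lia.
  rewrite -(ler_pM2l alpha_gt0) (le_trans alpha_le) // -natrM ler_nat.
  by rewrite mulnC.
have [n1|n_gt1] := leqP n 1.
  have /eqP n1E : n == 1%N by lia.
  exists (1%g : 'S_n); rewrite /e n1E ln1 sqrtr0 mulr0 powRr0 mulr1 ler_nat.
  apply/bigop.bigmax_leqP => A _; rewrite (leq_trans (max_card _)) // card_ord; lia.
have [p [j [lt_n]]] := exists_sparse_perm n_gt1.
set alpha := independence_number _ => /= le_alpha; exists p.
have e_le : e <= j.+1%:R / 4.
  have ln_n : ln (n%:R : R) <= (12 * j.+1%:R) ^+ 2.
    apply: (@le_trans _ _ (ln ((2 ^ (144 * j.+1 ^ 2))%:R : R))).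
      by rewrite ler_ln ?posrE ?ltr0n ?expn_gt0 // ler_nat ltnW.
    have -> : (12 * j.+1%:R) ^+ 2 = (144 * j.+1 ^ 2)%:R :> R.
      by rewrite natrM natrX; ring.
    rewrite natrX lnXn // -[leLHS]mulr_natl -[leRHS]mulr1 ler_wpM2l //.
    by have := @le_ln1Dx R 1; rewrite -[1 + 1]/2%R; apply; lra.
  have : Num.sqrt (ln (n%:R : R)) <= 12 * j.+1%:R.
    by rewrite -[leRHS]ger0_norm ?mulr_ge0 // -sqrtr_sqr ler_wsqrtr.
  rewrite /e; lra.
have pow_le (r : R) : e <= r -> alpha%:R * 2 `^ e <= alpha%:R * 2 `^ r :> R.
  by move=> er; rewrite ler_wpM2l // ler_powR // ler1n.
case: leqP le_alpha => [j1|j_gt1] le_alpha.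
  have e_half : e <= 2^-1.
    have : j.+1%:R <= 2 :> R by rewrite ler_nat.
    by move: e_le; lra.
  apply: le_trans (pow_le _ e_half) _; rewrite powR12_sqrt //.
  (* The bound 3/2 exactly offsets the ratio 2/3 of the case j <= 1. *)
  have sqrt2 : Num.sqrt 2 <= 3 / 2 :> R.
    by rewrite -[leRHS]ger0_norm ?divr_ge0 // -sqrtr_sqr ler_wsqrtr //; lra.
  have : 3 * alpha%:R <= 2 * n%:R :> R by rewrite -!natrM ler_nat.
  have := ler_wpM2l (ler0n R alpha) sqrt2; lra.
have e_pred : e <= j.-1%:R.
  have : 2 <= j%:R :> R by rewrite ler_nat.
  have : j%:R = j.-1%:R + 1 :> R by rewrite natr1 prednK //; lia.
  by move: e_le; rewrite -natr1; lra.
apply: le_trans (pow_le _ e_pred) _.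
by rewrite powR_mulrn // -natrX -natrM ler_nat.
Qed.
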